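(* There is a tall ideal $\mathcal{I}$ on $\mathbb{N}$ which is a $\mathbf{\Pi}^1_2$ subset of $2^{\mathbb{N}}$ such that for every $x\in\mathcal{I}^+$ and every $\mathcal{F}\subseteq[\mathbb{N}]^{<\omega}$ there is $y\subseteq x$ with $y\in hom(\mathcal{F})\cap\mathcal{I}^+$. In particular, $\mathcal{I}$ does not contain any closed, hereditary, tall subset of $2^{\mathbb{N}}$.
   Context: Subsets of $\mathbb{N}$ are identified with elements of $2^{\mathbb{N}}$. An ideal on $\mathbb{N}$ is a family $\mathcal{I}\subseteq 2^{\mathbb{N}}$ that is hereditary and closed under finite unions; $\mathcal{I}^+=2^{\mathbb{N}}\setminus\mathcal{I}$. A family $\mathcal{C}$ is tall if every infinite $x\subseteq\mathbb{N}$ has an infinite subset in $\mathcal{C}$; it is hereditary if it is closed under taking subsets. For finite $s$ and $t\subseteq\mathbb{N}$, $s\sqsubseteq t$ means $s=t\cap\{0,\dots,n\}$ for some $n$. For $\mathcal{F}\subseteq[\mathbb{N}]^{<\omega}$, $hom(\mathcal{F})$ is the set of infinite $y\subseteq\mathbb{N}$ such that either for every infinite $z\subseteq y$ there is $s\in\mathcal{F}$ with $s\sqsubseteq z$, or no finite subset of $y$ belongs to $\mathcal{F}$. *)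

(* Defs.v *)
From mathcomp Require Import all_boot.
Set Implicit Arguments. Unset Strict Implicit. Unset Printing Implicit Defensive.

Definition subsetN (y x : nat -> bool) : Prop := forall n, y n -> x n.
Definition infiniteN (x : nat -> bool) : Prop := forall n, exists m, n <= m /\ x m.
Definition finiteN (s : nat -> bool) : Prop := exists N, forall k, s k -> k < N.

Definition is_ideal (I : (nat -> bool) -> Prop) : Prop :=
  I (fun _ => false) /\
  (forall x y, I x -> subsetN y x -> I y) /\
  (forall x y, I x -> I y -> I (fun n => x n || y n)).

Definition hereditary (C : (nat -> bool) -> Prop) : Prop :=
  forall x y, C x -> subsetN y x -> C y.

Definition tall (C : (nat -> bool) -> Prop) : Prop :=
  forall x, infiniteN x -> exists y, subsetN y x /\ infiniteN y /\ C y.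

Definition initial_seg (s t : nat -> bool) : Prop :=
  exists n, forall k, s k = t k && (k <= n).

Definition hom (F : (nat -> bool) -> Prop) (y : nat -> bool) : Prop :=
  infiniteN y /\
  ((forall z, infiniteN z -> subsetN z y -> exists s, F s /\ initial_seg s z)
   \/ (forall s, finiteN s -> subsetN s y -> ~ F s)).

(* Closed subsets of 2^N: given by a set T of finite binary strings (a tree):
   x in C iff every initial segment of x lies in T. *)
Definition closed2N (C : (nat -> bool) -> Prop) : Prop :=
  exists T : seq bool -> Prop, forall x, C x <-> forall n, T (mkseq x n).

Definition closed3 (C : (nat -> bool) -> (nat -> nat) -> (nat -> nat) -> Prop) : Prop :=
  exists T : seq bool -> seq nat -> seq nat -> Prop,
    forall x y z, C x y z <-> forall n, T (mkseq x n) (mkseq y n) (mkseq z n).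

(* Boldface Pi^1_2 subsets of 2^N: A = {x | forall y in N^N, exists z in N^N,
   (x,y,z) in C} for some closed C (complement of projection of a Pi^1_1 set). *)
Definition Pi12 (A : (nat -> bool) -> Prop) : Prop :=
  exists C, closed3 C /\ forall x, A x <-> forall y, exists z, C x y z.

(* Main.v *)
(** Call a family of sets [y], indexed by finite sequences of reals, a tree of
nodes when the children of [y] are obtained as follows. Identify [y] with the
full binary tree; each real [F] gives a branch of [y], and two branches have
finite intersection. Reading [F] as a code for a family of finite sets, the
child of [y] at [F] is a canonically chosen homogeneous subset for [F] of the
branch [F], which exists by Galvin's lemma. The ideal consists of the sets
that include no node. Homogeneous positive sets exist by construction, and
closure under unions is the case of a family of singletons. Tallness holds
because an antichain of the binary tree on a node [y] includes no node: it has
finite intersection with every branch of [y], while nodes with infinite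
intersection are comparable.

For definability, the canonical homogeneous set is the lexicographically first
member of a closed subset of [[N]^w]: the sets with no finite subset in [F] if
there are any, and otherwise those whose finite subsets containing a member of
[F] all have an initial segment in [F]. Hence ``z is the child of y at F'' is
Pi^1_1, and ``x includes a node'' is Sigma^1_2. *)

Require Import Defs.
From mathcomp Require Import all_boot.
From mathcomp Require Import boolp classical_sets filter.

Set Implicit Arguments. Unset Strict Implicit. Unset Printing Implicit Defensive.

Local Open Scope classical_set_scope.

(** * Galvin's lemma *)

Definition below (z : nat -> bool) (n : nat) : seq nat := seq.filter z (iota 0 n).

Lemma mem_below z n k : (k \in below z n) = z k && (k < n).
Proof. by rewrite mem_filter mem_iota. Qed.

Lemma sorted_below z n : sorted ltn (below z n).
Proof. by apply: sorted_filter; [exact: ltn_trans | exact: iota_ltn_sorted]. Qed.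

Lemma below_cat z m n : m <= n ->
  below z n = below z m ++ seq.filter z (iota m (n - m)).
Proof.
by move=> mn; rewrite /below -filter_cat -{1}(subnKC mn) iotaD add0n.
Qed.

Lemma belowS z n : below z n.+1 = if z n then rcons (below z n) n else below z n.
Proof.
rewrite (below_cat z (leqnSn n)) subSnn /=.
by case: (z n); rewrite ?cats1 ?cats0.
Qed.

Lemma infinite_least z m : infiniteN z ->
  exists k, [/\ m <= k, z k & below z k = below z m].
Proof.
move=> zi; have exk : exists k, (m <= k) && z k.
  by have [k [mk zk]] := zi m; exists k; rewrite mk.
exists (ex_minn exk); case: ex_minnP => k /andP[mk zk] kmin; split=> //.
rewrite (below_cat z mk) -[RHS]cats0; congr (_ ++ _).
apply/eqP; rewrite -(negbK (_ == _)) -has_filter; apply/hasPn => j.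
rewrite mem_iota subnKC // => /andP[mj jk]; apply/negP => zj.
by have := kmin j; rewrite mj zj leqNgt jk => /(_ isT).
Qed.

Definition free_ultra (U : set (set nat)) (b : nat -> bool) : Prop :=
  [/\ UltraFilter U, U [set n | b n] & forall N, U [set n | N <= n]].

Lemma free_ultra_exists b : infiniteN b -> exists U, free_ultra U b.
Proof.
move=> bi.
(* The filter generated by the tails of [b], proper because [b] is infinite. *)
pose F : set_system nat := fun A => exists N, forall n, N <= n -> b n -> A n.
have FF : ProperFilter F.
  split; first by case=> N NF; have [m [Nm bm]] := bi N; exact: (NF m).
  split; first by exists 0.
    move=> A B [N NA] [M MB]; exists (maxn N M) => n.
    by rewrite geq_max => /andP[Nn Mn] bn; split; [exact: NA | exact: MB].
  by move=> A B AB [N NA]; exists N => n Nn bn; exact/AB/NA.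
have [U [UU FU]] := ultraFilterLemma FF; exists U; split=> //.
  by apply: FU; exists 0.
by move=> N; apply: FU; exists N.
Qed.

(* The elements of [y] chosen after [s] always lie in [T s]; built by
diagonalisation, since each stage imposes finitely many conditions. *)
Lemma ultra_diagonal b (U : set (set nat)) (T : seq nat -> set nat) :
  free_ultra U b -> (forall s, U (T s)) ->
  exists y, [/\ subsetN y b, infiniteN y &
    forall s n, sorted ltn s -> all y s -> all (ltn^~ n) s -> y n -> T s n].
Proof.
move=> [UU Ub Ucof] UT.
have Uall (ss : seq (seq nat)) : U [set n | forall s, s \in ss -> T s n].
  elim: ss => [|s ss IH]; first by apply: filterS filterT => n _ s.
  apply: filterS (filterI (UT s) IH) => n [Tn ssn] t.
  by rewrite inE => /orP[/eqP->|/ssn].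
have nextP (l : seq nat) : exists n,
    [/\ b n, all (ltn^~ n) l & forall s, subseq s l -> T s n].
  (* The masks of [l] list all its subsequences, so a single set of [U] meets the conditions of all
     of them at once. *)
  have := Uall [seq mask (val m) l | m : (size l).-tuple bool].
  move=> /(filterI Ub) /(filterI (Ucof (foldr maxn 0 l).+1)).
  move=> /filter_ex[n /= [ln [bn Tn]]]; exists n; split=> //.
    apply/allP => k kl; apply: leq_trans ln; rewrite ltnS.
    elim: l kl {Tn} => //= a l IH; rewrite inE leq_max => /orP[/eqP->|/IH->].
      by rewrite leqnn.
    by rewrite orbT.
  move=> s /subseqP[m sm ->]; apply: Tn; apply/mapP.
  by exists (tcast (esym (esym sm)) (in_tuple m)); rewrite ?mem_enum ?val_tcast.
have [next nextE] := choice nextP.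
pose st := fix st k := if k is k'.+1 then rcons (st k') (next (st k')) else [::].
have st_mono j k : j <= k -> {subset st j <= st k}.
  elim: k => [|k IH]; first by rewrite leqn0 => /eqP->.
  rewrite leq_eqVlt => /orP[/eqP->//|/IH jk] a /jk ak.
  by rewrite /= mem_rcons inE ak orbT.
have st_sorted k : sorted ltn (st k).
  elim: k => //= k IH; have [_ lt _] := nextE (st k).
  case: (st k) IH lt => // a l IH lt.
  rewrite /= rcons_path; apply/andP; split=> //; have /allP := lt; apply; exact: mem_last.
have st_next j k : j < k -> next (st j) \in st k.
  by move=> jk; apply: (st_mono _ _ jk); rewrite /= mem_rcons mem_head.
have next_lt j k : j < k -> next (st j) < next (st k).
  by move=> /st_next jk; have [_ /allP /(_ _ jk)] := nextE (st k).
have st_in k a : a \in st k -> exists j, a = next (st j).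
  elim: k => //= k IH; rewrite mem_rcons inE => /orP[/eqP->|]; last exact: IH.
  by exists k.
pose y n := `[< exists k, n = next (st k) >].
have yn k : y (next (st k)) by apply/asboolP; exists k.
have lenext k : k <= next (st k).
  by elim: k => // k IH; apply: leq_ltn_trans IH (next_lt _ _ _).
exists y; split.
- by move=> n /asboolP[k ->]; have [] := nextE (st k).
- by move=> n; exists (next (st n)).
move=> s n ss ys sn /asboolP[k nk]; have [_ _] := nextE (st k).
(* [s] is a subsequence of [st k]: two increasing lists with the same members are equal, and every
   element of [s] was chosen before stage [k]. *)
rewrite -nk; apply; apply: (subseq_trans (y := seq.filter (mem s) (st k))).
  suff -> : seq.filter (mem s) (st k) = s by [].
  apply: (irr_sorted_eq ltn_trans ltnn) => //.
    by apply: sorted_filter => //; exact: ltn_trans.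
  move=> a; rewrite mem_filter /=; case as_: (a \in s) => //=.
  have /asboolP[j aj] := allP ys _ as_.
  have := allP sn _ as_; rewrite /= aj nk => lt.
  apply: st_next; rewrite ltnNge; apply/negP; rewrite leq_eqVlt => /orP[/eqP kj|].
    by rewrite kj ltnn in lt.
  by move/next_lt/(ltn_trans lt); rewrite ltnn.
exact: filter_subseq.
Qed.

(* The initial positions from which a player adding elements one at a time,
with every choice ranging over some set of [U], is sure to reach [F]. *)
Inductive ultra_won (U : set (set nat)) (F : seq nat -> Prop) : seq nat -> Prop :=
| ultra_won_here s : F s -> ultra_won U F s
| ultra_won_next s (A : set nat) :
    U A -> (forall n, A n -> ultra_won U F (rcons s n)) -> ultra_won U F s.

Lemma ultra_won_strategy U b F s : free_ultra U b -> ultra_won U F s ->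
  exists T : seq nat -> set nat, (forall t, U (T t)) /\
    forall z m, infiniteN z -> below z m = s ->
      (forall k, m <= k -> z k -> T (below z k) k) -> exists n, F (below z n).
Proof.
move=> [UU _ _]; elim=> [{}s Fs|{}s A UA _ IH].
  by exists (fun=> setT); split=> [_|z m _ zm _]; [exact: filterT | by exists m; rewrite zm].
have /choice[T TP] n : exists T : seq nat -> set nat, (forall t, U (T t)) /\ (A n ->
    forall z m, infiniteN z -> below z m = rcons s n ->
      (forall k, m <= k -> z k -> T (below z k) k) -> exists n, F (below z n)).
  have [/IH[T [UT TP]]|nA] := pselect (A n); first by exists T.
  by exists (fun=> setT); split=> // _; exact: filterT.
(* A position extending [s] records the move made at [s] as its entry of index [size s]; this entry
   selects the strategy to follow from there on. *)
exists (fun t => if t == s then A else T (nth 0 t (size s)) t); split.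
  by move=> t; case: ifP => // _; exact: (TP _).1.
move=> z m zi zm Tz; have [k [mk zk]] := infinite_least m zi.
rewrite zm => zks; have Ak : A k by have := Tz k mk zk; rewrite zks eqxx.
have zkS : below z k.+1 = rcons s k by rewrite belowS zk zks.
apply: ((TP k).2 Ak z k.+1 zi zkS) => j kj zj.
have := Tz j (leq_trans mk (ltnW kj)) zj.
rewrite (below_cat z kj) zkS cat_rcons.
rewrite -{2}(cats0 s) eqseq_cat // eqxx /= nth_cat ltnn subnn //.
Qed.

(** If the empty position is won, diagonalising along a strategy makes every infinite subset of [y]
    a play that follows it, hence one that reaches [F]. Otherwise, [U] being an ultrafilter, each
    unwon position has [U]-many unwon one-point extensions; diagonalising along these leaves every
    finite subset of [y] unwon, hence outside [F]. *)
Lemma galvin (F : (nat -> bool) -> Prop) b : infiniteN b ->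
  exists y, [/\ subsetN y b, infiniteN y &
    (forall z, infiniteN z -> subsetN z y -> exists n, F (fun k => z k && (k < n)))
    \/ (forall s, finiteN s -> subsetN s y -> ~ F s)].
Proof.
move=> /free_ultra_exists[U bU]; pose FL (s : seq nat) := F (mem s).
have FLE z n : FL (below z n) = F (fun k => z k && (k < n)).
  by congr F; apply: funext => k; rewrite /= mem_below.
have [won|lost] := pselect (ultra_won U FL [::]).
  have [T [UT TP]] := ultra_won_strategy bU won.
  have [y [yb yi yT]] := ultra_diagonal bU UT; exists y; split=> //; left=> z zi zy.
  have [|n] := TP z 0 zi erefl; last by rewrite FLE; exists n.
  move=> k _ zk; apply: yT; [exact: sorted_below | | | exact: zy].
    by apply/allP => j; rewrite mem_below => /andP[/zy].
  by apply/allP => j; rewrite mem_below => /andP[].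
have UU : UltraFilter U by case: bU.
pose T s : set nat := [set n | ~ ultra_won U FL s -> ~ ultra_won U FL (rcons s n)].
have UT s : U (T s).
  have [ws|ls] := pselect (ultra_won U FL s).
    by apply: filterS filterT => n _ /(_ ws).
  have [A|] := in_ultra_setVsetC [set n | ultra_won U FL (rcons s n)] UU.
    by case: ls; apply: ultra_won_next A _.
  by apply: filterS => n ln _.
have [y [yb yi yT]] := ultra_diagonal bU UT; exists y; split=> //; right=> s [N sN] sy Fs.
suff : ~ ultra_won U FL (below s N).
  apply; apply: ultra_won_here; rewrite FLE; move: Fs; congr F.
  by apply: funext => k; case sk: (s k) => //=; rewrite (sN k sk).
elim: N {sN} => // N IH; rewrite belowS; case: ifP => // sNN.
apply: yT IH; [exact: sorted_below | | | exact: sy].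
  by apply/allP => j; rewrite mem_below => /andP[/sy].
by apply/allP => j; rewrite mem_below => /andP[].
Qed.

(** * Binary trees on infinite sets *)

Definition rank (y : nat -> bool) (n : nat) : nat := size (below y n).

Lemma rankS y n : rank y n.+1 = y n + rank y n.
Proof. by rewrite /rank belowS; case: (y n); rewrite ?size_rcons. Qed.

Lemma rank_mono y m n : m <= n -> rank y m <= rank y n.
Proof. by move=> mn; rewrite /rank (below_cat y mn) size_cat leq_addr. Qed.

Lemma rank_lt (y : nat -> bool) m n : y m -> m < n -> rank y m < rank y n.
Proof. by move=> ym /(rank_mono y); rewrite rankS ym. Qed.

Lemma rank_le y n : rank y n <= n.
Proof. by rewrite /rank size_filter -{2}(size_iota 0 n) count_size. Qed.

Lemma rank_surj (y : nat -> bool) r : infiniteN y -> exists n, y n /\ rank y n = r.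
Proof.
move=> yi; elim: r => [|r [n [yn nr]]].
  have [k [_ yk ky]] := infinite_least 0 yi.
  by exists k; split=> //; rewrite /rank ky.
have [k [_ yk ky]] := infinite_least n.+1 yi.
by exists k; split=> //; rewrite /rank ky -/(rank y n.+1) rankS yn nr.
Qed.

Lemma rank_unbounded (w y : nat -> bool) r : infiniteN w -> subsetN w y ->
  exists n, w n /\ r <= rank y n.
Proof.
move=> wi wy; elim: r => [|r [n [wn rn]]].
  by have [n [_ wn]] := wi 0; exists n.
have [m [nm wm]] := wi n.+1; exists m; split=> //.
by apply: leq_ltn_trans rn (rank_lt _ nm); exact: wy.
Qed.

Lemma injective_unbounded (f : nat -> nat) m : injective f -> exists k, m <= f k.
Proof.
move=> finj; apply: contrapT => nex.
have fm k : f k < m by rewrite ltnNge; apply/negP => mk; apply: nex; exists k.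
have : size (map f (iota 0 m.+1)) <= size (iota 0 m).
  apply: uniq_leq_size; first by rewrite map_inj_uniq // iota_uniq.
  by move=> _ /mapP[k _ ->]; rewrite mem_iota add0n fm.
by rewrite size_map !size_iota ltnn.
Qed.

(** Common to branches and antichains, with [f] listing infinitely many of the codes to be
    selected. *)
Lemma rank_select_infinite y (f : nat -> nat) (P : pred nat) :
  infiniteN y -> injective f -> (forall k, P (f k)) ->
  infiniteN (fun n => [&& 0 < n, y n & P (rank y n)]).
Proof.
move=> yi finj Pf m; have [k mk] := injective_unbounded m.+1 finj.
have [n [yn nr]] := rank_surj (f k) yi; exists n.
have mn : m < n by apply: leq_trans mk _; rewrite -nr rank_le.
by rewrite (ltnW mn) (leq_ltn_trans _ mn) // yn nr Pf.
Qed.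

(* Enumerating [y] increasingly identifies it with the binary tree [seq bool];
the real [F] then determines the branch of the elements coding its prefixes. The element 0 is
left out because [initial_seg] makes the empty set an initial segment of [t]
only if [t 0] is false. *)
Definition prefix_code (F : nat -> bool) (r : nat) : bool :=
  if pickle_inv r is Some l then l == mkseq F (size l) else false.

Definition branch (y F : nat -> bool) (n : nat) : bool :=
  [&& 0 < n, y n & prefix_code F (rank y n)].

Lemma branch_sub y F : subsetN (branch y F) y.
Proof. by move=> n /and3P[]. Qed.

Lemma branch_infinite y F : infiniteN y -> infiniteN (branch y F).
Proof.
move=> yi.
apply: (rank_select_infinite (f := fun k => pickle (mkseq F k)) (P := prefix_code F) yi).
  move=> j k /(pcan_inj pickleK) /(congr1 size).
  by rewrite !size_mkseq.
by move=> k; rewrite /prefix_code pickleK_inv size_mkseq.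
Qed.

(** Only finitely many elements code prefixes of [F] of length at most [d]. An element of [w] of
    larger rank codes a longer common prefix of [F] and [G], so they agree at [d]. *)
Lemma branch_inj y F G w : infiniteN w ->
  subsetN w (branch y F) -> subsetN w (branch y G) -> F = G.
Proof.
move=> wi wF wG; apply: funext => d.
have wy : subsetN w y by move=> n /wF /branch_sub.
have [n [wn]] := rank_unbounded (\max_(s < d.+1) pickle (mkseq F s)).+1 wi wy.
have /and3P[_ _] := wF n wn; have /and3P[_ _] := wG n wn.
rewrite /prefix_code; case rl: (pickle_inv (rank y n)) => [l|] // /eqP lG /eqP lF.
have [dl _|ld] := ltnP d (size l).
  by rewrite -(nth_mkseq false F dl) -(nth_mkseq false G dl) -lF -lG.
have := pickle_invK (T := seq bool) (rank y n); rewrite rl /= => <-.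
by rewrite ltnNge lF (@leq_bigmax _ (fun s : 'I_d.+1 => pickle (mkseq F s)) (Ordinal (ld : size l < d.+1))) //.
Qed.

(** The strings consisting of some [true] followed by one [false] are pairwise incomparable under
    the prefix order. *)
Definition antichain_code (r : nat) : bool :=
  if pickle_inv r is Some l then l == rcons (nseq (size l).-1 true) false else false.

Definition antichain (y : nat -> bool) (n : nat) : bool :=
  [&& 0 < n, y n & antichain_code (rank y n)].

Lemma antichain_sub y : subsetN (antichain y) y.
Proof. by move=> n /and3P[]. Qed.

Lemma antichain_infinite y : infiniteN y -> infiniteN (antichain y).
Proof.
move=> yi.
apply: (rank_select_infinite (f := fun k => pickle (rcons (nseq k true) false))
  (P := antichain_code) yi).
  move=> j k /(pcan_inj pickleK) /(congr1 size).
  by rewrite !size_rcons !size_nseq => -[].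
by move=> k; rewrite /antichain_code pickleK_inv size_rcons size_nseq.
Qed.

(** Two elements of [w] would code prefixes of [F] of the form all [true], then [false]. Both end at
    the first zero of [F], so the codes, and with them the ranks, coincide. *)
Lemma antichain_branch y F w : infiniteN w ->
  subsetN w (antichain y) -> ~ subsetN w (branch y F).
Proof.
move=> wi wA wB.
have code n : w n -> exists k,
    [/\ pickle_inv (rank y n) = Some (rcons (nseq k true) false),
        forall j, j < k -> F j & F k = false].
  move=> wn; have /and3P[_ _] := wA n wn; have /and3P[_ _] := wB n wn.
  rewrite /antichain_code /prefix_code; case: pickle_inv => // l /eqP lF /eqP lA.
  move: lF; rewrite lA; move: (size l).-1 => k; rewrite size_rcons size_nseq => lF.
  exists k; split=> // [j jk|].
    by rewrite -(nth_mkseq false F (leqW jk)) -lF nth_rcons size_nseq jk nth_nseq jk.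
  by rewrite -(nth_mkseq false F (ltnSn k)) -lF nth_rcons size_nseq ltnn eqxx.
have [n [_ wn]] := wi 0; have [m [nm wm]] := wi n.+1.
have [j [nj Fj Fj0]] := code n wn; have [k [mk Fk Fk0]] := code m wm.
have jk : j = k.
  by case: (ltngtP j k) => // [/Fk|/Fj]; rewrite ?Fj0 ?Fk0.
have yn : y n by apply/antichain_sub/wA.
have := rank_lt yn nm.
suff -> : rank y n = rank y m by rewrite ltnn.
have := pickle_invK (T := seq bool) (rank y n); rewrite nj jk.
by have := pickle_invK (T := seq bool) (rank y m); rewrite mk /= => -> .
Qed.

(** * Canonical homogeneous sets *)

Definition seg_sub (l : seq bool) (y : nat -> bool) : bool :=
  all (fun k => nth false l k ==> y k) (iota 0 (size l)).

Lemma seg_subP l y : reflect (subsetN (nth false l) y) (seg_sub l y).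
Proof.
apply: (iffP allP) => [ly k lk|ly k _]; last by apply/implyP => /ly.
have := ly k; rewrite mem_iota lk; apply.
by rewrite /= ltnNge; apply/negP => kl; rewrite nth_default in lk.
Qed.

Lemma mkseq_eqP (y z : nat -> bool) n :
  (mkseq y n = mkseq z n) <-> (forall k, k < n -> y k = z k).
Proof.
split=> [yz k kn|yz]; first by rewrite -(nth_mkseq false y kn) yz nth_mkseq.
by apply/eq_in_map => k; rewrite mem_iota => /yz.
Qed.

Lemma seg_sub_agree l y z n : mkseq y n = mkseq z n -> size l <= n ->
  seg_sub l y = seg_sub l z.
Proof.
move=> /mkseq_eqP yz ln; apply: eq_in_all => k; rewrite mem_iota /= => kl.
by rewrite yz // (leq_trans kl).
Qed.

Lemma nth_mkseq_restr (y : nat -> bool) n :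
  nth false (mkseq y n) = fun k => y k && (k < n).
Proof.
apply: funext => k; have [kn|nk] := ltnP k n; first by rewrite nth_mkseq // andbT.
by rewrite andbF nth_default // size_mkseq.
Qed.

Lemma nth_take_restr (l : seq bool) n :
  nth false (take n l) = fun k => nth false l k && (k < n).
Proof.
apply: funext => k; have [kn|nk] := ltnP k n; first by rewrite nth_take // andbT.
by rewrite andbF nth_default // size_take_min geq_min nk.
Qed.

Lemma finiteN_mkseq s : finiteN s -> exists N, s = nth false (mkseq s N).
Proof.
move=> [N sN]; exists N; rewrite nth_mkseq_restr; apply: funext => k.
by case sk: (s k) => //=; rewrite (sN k sk).
Qed.

Lemma finiteN_nth l : finiteN (nth false l).
Proof.
exists (size l) => k lk; rewrite ltnNge; apply/negP => kl.
by rewrite nth_default in lk.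
Qed.

Definition family_code (G : (nat -> bool) -> Prop) (r : nat) : bool :=
  `[< exists l : seq bool, r = pickle l /\ G (nth false l) >].

Lemma family_codeP G l : reflect (G (nth false l)) (family_code G (pickle l)).
Proof.
apply: (iffP (asboolP _)) => [[l' [/(pcan_inj pickleK) <-]] //|Gl].
by exists l.
Qed.

Definition homE (b F y : nat -> bool) : Prop :=
  [/\ infiniteN y, subsetN y b & forall l, seg_sub l y -> ~~ F (pickle l)].

(* When [homE b F] is empty, membership in this closed condition implies the
first alternative of [hom], although the latter is only coanalytic. *)
Definition homK (b F y : nat -> bool) : Prop :=
  [/\ infiniteN y, subsetN y b &
      forall l l', seg_sub l y -> seg_sub l' (nth false l) -> F (pickle l') ->
        has (fun n => F (pickle (take n l))) (iota 0 (size l).+1)].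

(** The strict lexicographic order with [true] before [false]; this direction is what keeps the
    first member infinite in [leftmost_exists]. *)
Definition beats (y z : nat -> bool) : Prop :=
  exists n, [&& mkseq y n == mkseq z n, y n & ~~ z n].

Definition leftmost (H : (nat -> bool) -> Prop) (y : nat -> bool) : Prop :=
  H y /\ forall z, H z -> ~ beats z y.

Lemma leftmost_uniq H y z : leftmost H y -> leftmost H z -> y = z.
Proof.
move=> [Hy ly] [Hz lz]; apply: contrapT => yz.
have ex : exists n, y n != z n.
  apply: contrapT => nex; apply: yz; apply: funext => n; apply/eqP.
  by rewrite -(negbK (_ == _)); apply/negP => yzn; apply: nex; exists n.
case: (ex_minnP ex) => n yzn nmin.
have agree : mkseq y n = mkseq z n.
  apply/mkseq_eqP => k kn; apply/eqP; rewrite -(negbK (_ == _)); apply/negP.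
  by move=> /nmin; rewrite leqNgt kn.
case yn: (y n) yzn; case zn: (z n) => // _.
  by apply: (lz y Hy); exists n; rewrite agree eqxx yn zn.
by apply: (ly z Hz); exists n; rewrite agree eqxx yn zn.
Qed.

(** Choose [true] whenever some member of [H] extends the prefix so obtained. As [H] is closed only
    relative to the infinite sets, the limit must be shown infinite: if it had no element from [n]
    on, a member of [H] agreeing with it below [n] could never depart from it, and would be finite
    as well. *)
Lemma leftmost_exists H :
  (forall y, H y -> infiniteN y) ->
  (forall y, infiniteN y ->
    (forall n, exists2 z, H z & mkseq z n = mkseq y n) -> H y) ->
  (exists y, H y) -> exists y, leftmost H y.
Proof.
move=> Hinf Hcl [y0 Hy0].
pose ext l := exists2 z, H z & mkseq z (size l) = l.
pose p := fix p n := if n is n'.+1 then rcons (p n') `[< ext (rcons (p n') true) >]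
                     else [::].
pose y n := `[< ext (rcons (p n) true) >].
have yp n : mkseq y n = p n by elim: n => // n IH; rewrite mkseqS IH.
have sp n : size (p n) = n by rewrite -yp size_mkseq.
have next z n : H z -> mkseq z n = p n -> z n -> y n.
  by move=> Hz zn zn1; apply/asboolP; exists z => //; rewrite size_rcons sp mkseqS zn zn1.
have extp n : ext (p n).
  elim: n => [|n [z Hz]]; first by exists y0.
  rewrite sp => zn /=; have [//|nyn] := pselect (ext (rcons (p n) true)).
    by move=> e; rewrite (asboolT e).
  rewrite (asboolF nyn); exists z => //; rewrite size_rcons sp mkseqS zn.
  by case zn1: (z n) => //; case: nyn; apply/asboolP; exact: next zn1.
have yi : infiniteN y.
  move=> n; have [z Hz] := extp n; rewrite sp => zn; have [m [nm zm]] := Hinf z Hz n.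
  apply: contrapT => nex.
  have agree k : n <= k -> mkseq z k = p k.
    elim: k => [|k IH]; first by rewrite leqn0 => /eqP n0; move: zn; rewrite n0.
    rewrite leq_eqVlt => /orP[/eqP<- //|nk]; rewrite -yp !mkseqS yp IH //.
    case zk: (z k).
      by case: nex; exists k; split=> //; apply: next zk => //; exact: IH.
    by case yk: (y k) => //; case: nex; exists k.
  by apply: nex; exists m; split=> //; apply: next (zm) => //; exact: agree.
exists y; split.
  apply: Hcl => // n; have [z Hz] := extp n; rewrite sp => zn.
  by exists z => //; rewrite yp.
move=> z Hz [n /and3P[/eqP zn zn1]]; apply/negP; rewrite negbK.
by apply: next zn1 => //; rewrite -yp.
Qed.

Lemma subsetN_closed (y b : nat -> bool) :
  (forall n, exists2 z, subsetN z b & mkseq z n = mkseq y n) -> subsetN y b.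
Proof.
move=> ycl n yn; have [z zb /mkseq_eqP zy] := ycl n.+1.
by apply: zb; rewrite zy.
Qed.

Lemma homE_leftmost b F : (exists y, homE b F y) -> exists y, leftmost (homE b F) y.
Proof.
apply: leftmost_exists => [y []//|y yi ycl]; split=> //.
  by apply: subsetN_closed => n; have [z [_ zb _] zy] := ycl n; exists z.
move=> l ly; have [z [_ _ zF] zy] := ycl (size l).
by apply: zF; rewrite (seg_sub_agree zy).
Qed.

Lemma homK_leftmost b F : (exists y, homK b F y) -> exists y, leftmost (homK b F) y.
Proof.
apply: leftmost_exists => [y []//|y yi ycl]; split=> //.
  by apply: subsetN_closed => n; have [z [_ zb _] zy] := ycl n; exists z.
move=> l l' ly; have [z [_ _ zF] zy] := ycl (size l).
by apply: zF; rewrite (seg_sub_agree zy).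
Qed.

Definition sel (b F y : nat -> bool) : Prop :=
  leftmost (homE b F) y \/ ((forall z, ~ homE b F z) /\ leftmost (homK b F) y).

Lemma sel_uniq b F y z : sel b F y -> sel b F z -> y = z.
Proof.
move=> [ly|[nE ly]] [lz|[nE' lz]]; try exact: leftmost_uniq ly lz.
  by case: ly => /nE'.
by case: lz => /nE.
Qed.

Lemma sel_sub b F y : sel b F y -> subsetN y b.
Proof. by case=> [|[_]] [[]]. Qed.

Lemma sel_infinite b F y : sel b F y -> infiniteN y.
Proof. by case=> [|[_]] [[]]. Qed.

(* Apply Galvin's lemma to the finite sets containing an element of [G]
without having an initial segment in [G]. *)
Lemma homK_nonempty b G : infiniteN b -> (forall y, ~ homE b (family_code G) y) ->
  exists y, homK b (family_code G) y.
Proof.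
move=> bi nE; pose restr (s : nat -> bool) n k := s k && (k < n).
pose hit s := exists2 t, finiteN t /\ subsetN t s & G t.
have [y [yb yi]] := galvin (fun s => hit s /\ forall n, ~ G (restr s n)) bi.
case=> [bad|good]; last first.
  exists y; split=> // l l' /seg_subP ly /seg_subP l'l /family_codeP Gl'.
  apply: contrapT => /negP /hasPn nG; apply: (good (nth false l)) => //.
    exact: finiteN_nth.
  split; first by exists (nth false l') => //; split=> //; exact: finiteN_nth.
  move=> n; have -> : restr (nth false l) n = nth false (take n l).
    by rewrite nth_take_restr.
  move=> /family_codeP Gn.
  have [nl|ln] := ltnP n (size l).+1.
    by have := nG n; rewrite mem_iota add0n nl Gn => /(_ isT).
  have := nG (size l); rewrite mem_iota add0n ltnSn take_size => /(_ isT).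
  by rewrite -{1}(take_oversize (ltnW ln)) Gn.
exfalso.
have hitS s t : subsetN s t -> hit s -> hit t.
  by move=> st [u [uf us] Gu]; exists u => //; split=> // n /us /st.
have ex : exists m, `[< hit (restr y m) >].
  apply: contrapT => nhit; apply: (nE y); split=> // l /seg_subP ly.
  apply/family_codeP => Gl; apply: nhit; exists (size l); apply/asboolP.
  exists (nth false l) => //; split; first exact: finiteN_nth.
  move=> k lk; rewrite /restr ly //= ltnNge; apply/negP => kl.
  by rewrite nth_default in lk.
case: (ex_minnP ex) => m /asboolP[t [tf ty] Gt] mmin.
(* Replacing [y] below [m] by [t] makes [t] an initial segment of [z]. A bad initial segment of [z]
   has length at least [m] by minimality, so it has [t], a member of [G], as an initial segment. *)
pose z k := if k < m then t k else y k.
have zy : subsetN z y.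
  by move=> k; rewrite /z; case: ifP => // _ /ty /andP[].
have zi : infiniteN z.
  move=> n; have [k [nk yk]] := yi (maxn n m).
  move: nk; rewrite geq_max => /andP[nk mk]; exists k; split=> //.
  by rewrite /z ltnNge mk.
have [n [hn nG]] := bad z zi zy.
have [nm|mn] := ltnP n m.
  have /mmin : `[< hit (restr y n) >].
    apply/asboolP; apply: hitS hn => k /andP[/zy yk kn].
    by rewrite /restr yk kn.
  by rewrite leqNgt nm.
apply: (nG m); move: Gt; congr G; apply: funext => k; rewrite /restr /z.
have [km|mk] := ltnP k m; first by rewrite (leq_trans km mn) !andbT.
by rewrite andbF; case tk: (t k) => //; have /andP[_] := ty k tk; rewrite ltnNge mk.
Qed.

Lemma sel_exists b G : infiniteN b -> exists y, sel b (family_code G) y.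
Proof.
move=> bi; have [exE|nE] := pselect (exists y, homE b (family_code G) y).
  by have [y ly] := homE_leftmost exE; exists y; left.
have nE' y : ~ homE b (family_code G) y by move=> Ey; apply: nE; exists y.
have [y ly] := homK_leftmost (homK_nonempty bi nE').
by exists y; right.
Qed.

(** In the second case an infinite [z] inside [y] is not in [homE], so it includes some member of
    [G]. An initial segment of [z] long enough to include that member has, by [homK], an initial
    segment in [G]. *)
Lemma sel_hom b G y : ~~ b 0 -> sel b (family_code G) y -> hom G y.
Proof.
move=> b0 sy; split; first exact: sel_infinite sy.
have yb := sel_sub sy; case: sy => [[[_ _ yE] _]|[nE [[_ _ yK] _]]].
  right=> s /finiteN_mkseq[N ->] sy /family_codeP; apply/negP/yE.
  exact/seg_subP.
left=> z zi zy.
have /existsNP[l /not_implyP[/seg_subP lz /negP/negPn Gl]] :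
    ~ forall l, seg_sub l z -> ~~ family_code G (pickle l).
  by move=> zE; apply: (nE z); split=> // n /zy /yb.
pose L := mkseq z (size l).
have Ly : seg_sub L y.
  by apply/seg_subP; rewrite nth_mkseq_restr => k /andP[/zy].
have lL : seg_sub l (nth false L).
  apply/seg_subP => k lk; rewrite nth_mkseq_restr lz //= ltnNge.
  by apply/negP => kl; rewrite nth_default in lk.
have /hasP[n _ /family_codeP Gn] := yK L l Ly lL Gl.
exists (nth false (take n L)); split=> //.
rewrite nth_take_restr nth_mkseq_restr.
(* The bound in [initial_seg] is inclusive, so a cut of length [m.+1] has witness [m]. The empty cut
   takes witness 0, which is correct because 0 is not in [b]. *)
case mE: (minn (size l) n) => [|m]; [exists 0 | exists m] => k; rewrite -andbA -leq_min ?mE //.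
case: k => [|k]; last by rewrite !andbF.
by rewrite !andbF andbT; apply/esym/negbTE; apply: contra b0 => /zy /yb.
Qed.

(** * Nodes and the ideal *)

Inductive reach : (nat -> bool) -> (nat -> bool) -> Prop :=
| reach_refl y : reach y y
| reach_step y F z w : sel (branch y F) F z -> reach z w -> reach y w.

Lemma reach_rcons y z F w : reach y z -> sel (branch z F) F w -> reach y w.
Proof.
elim=> {y z} [y sw|y G z v sz _ IH /IH]; last exact: reach_step sz.
by apply: reach_step sw _; exact: reach_refl.
Qed.

Lemma reach_sub y z : reach y z -> subsetN z y.
Proof.
elim=> {y z} [y n //|y F z w sz _ wz n /wz zn].
by apply: (@branch_sub y F); exact: (sel_sub sz).
Qed.

Lemma reach_infinite y z : infiniteN y -> reach y z -> infiniteN z.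
Proof. by move=> yi yz; elim: yz yi => // {}y F {}z w /sel_infinite zi _ IH _; exact: IH. Qed.

(** Follow both paths down from [r]. If both take a step, [w] lies in both branches, so the reals
    agree by [branch_inj] and the children by [sel_uniq]. *)
Lemma reach_comparable r y z w : reach r y -> reach r z ->
  infiniteN w -> subsetN w y -> subsetN w z -> reach y z \/ reach z y.
Proof.
move=> ry rz wi; elim: ry z rz => {r y} [r z rz _ _|r F u y su uy IH z rz wy wz].
  by left.
case: r z / rz su wz => [r su _|r G v z sv vz su wz].
  by right; apply: reach_step su uy.
have FG : F = G.
  apply: (branch_inj (y := r) wi) => n wn.
    exact/(sel_sub su)/(reach_sub uy)/wy.
  exact/(sel_sub sv)/(reach_sub vz)/wz.
by move: sv; rewrite -FG => /(sel_uniq su) uv; apply: IH => //; rewrite uv.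
Qed.

Lemma antichain_no_branch y F w : infiniteN y ->
  subsetN w (antichain y) -> ~ subsetN (branch y F) w.
Proof.
move=> yi wA Bw; apply: (@antichain_branch y F (branch y F)) => // [|n bn].
  exact: branch_infinite.
exact/wA/Bw.
Qed.

Lemma branch_proper y F : infiniteN y -> ~ subsetN y (branch y F).
Proof.
move=> yi yB.
have sub G : subsetN (branch y G) (branch y F) by move=> n /branch_sub /yB.
have [G FG] : exists G, F <> G.
  by exists (fun n => ~~ F n) => /(congr1 (fun f => f 0)) /=; case: (F 0).
by apply: FG; apply: (branch_inj (branch_infinite G yi)).
Qed.

Definition node : (nat -> bool) -> Prop := reach (fun _ => true).

Lemma node_infinite y : node y -> infiniteN y.
Proof. by apply: reach_infinite => n; exists n. Qed.

Definition nodeless (x : nat -> bool) : Prop := forall y, node y -> ~ subsetN y x.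

Lemma antichain_nodeless y : node y -> nodeless (antichain y).
Proof.
move=> ny z nz zA; have yi := node_infinite ny; have zi := node_infinite nz.
have zy : subsetN z y by move=> n /zA /antichain_sub.
have [|] := reach_comparable ny nz zi zy (fun _ => id).
  move=> yz; case: yz zy zA yi {ny nz} zi => {y z} [y|y F u z su uz] zy zA yi zi.
    by apply: (antichain_no_branch (F := fun=> true) yi zA); exact: branch_sub.
  by apply: (antichain_branch (F := F) zi zA) => n /(reach_sub uz) /(sel_sub su).
(* Here [y] is [z] or a descendant of it. A proper descendant lies in a branch of [z], which cannot
   include all of [z]. *)
move=> zy'; case: zy' zy zA zi {ny nz} yi => {y z} [y|z F u y su uy] zy zA zi yi.
  by apply: (antichain_no_branch (F := fun=> true) yi zA); exact: branch_sub.
by apply: (branch_proper (F := F) zi) => n /zy /(reach_sub uy) /(sel_sub su).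
Qed.

Lemma positive_node x : ~ nodeless x -> exists2 y, node y & subsetN y x.
Proof.
by move=> /existsNP[y /not_implyP[ny /contrapT yx]]; exists y.
Qed.

Lemma node_hom y G : node y -> exists z, [/\ node z, subsetN z y & hom G z].
Proof.
move=> ny; have bi := branch_infinite (family_code G) (node_infinite ny).
have [z sz] := sel_exists G bi; exists z; split.
- exact: reach_rcons sz.
- by move=> n /(sel_sub sz) /branch_sub.
- by apply: sel_hom sz; rewrite /branch.
Qed.

Lemma nodeless_hom x G : ~ nodeless x ->
  exists y, subsetN y x /\ hom G y /\ ~ nodeless y.
Proof.
move=> /positive_node[y ny yx]; have [z [nz zy Gz]] := node_hom G ny.
by exists z; split; [move=> n /zy /yx | split=> // /(_ z nz); apply].
Qed.

Lemma nodeless_ideal : is_ideal nodeless.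
Proof.
split; [|split].
- by move=> y /node_infinite yi yx; have [n [_ /yx]] := yi 0.
- by move=> x y Ix yx z nz zy; apply: (Ix z nz) => n /zy /yx.
move=> x y Ix Iy w nw wxy.
have [z [nz zw [zi hz]]] := node_hom (fun s => exists2 n, x n & s = pred1 n) nw.
case: hz => [allx|nox]; [apply: (Ix z nz) | apply: (Iy z nz)] => n zn.
  (* Apply homogeneity to the tail of [z] from [n]: an initial segment of it that is a singleton can
     only be the singleton of its least element [n], so [n] is in [x]. *)
  have [| k /andP[]//|s [[m xm ->] [N sN]]] := allx (fun k => z k && (n <= k)).
    move=> k; have [m [km zm]] := zi (maxn n k); move: km; rewrite geq_max => /andP[nm km].
    by exists m; rewrite zm nm.
  have := sN m; rewrite /= eqxx => /esym/andP[/andP[_ nm] mN].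
  have := sN n; rewrite zn leqnn (leq_trans nm mN) /= => /eqP nm'.
  by rewrite nm'.
have /orP[xn|//] := wxy n (zw n zn).
case: (nox (pred1 n)) => //; last by exists n.
  by exists n.+1 => k /eqP ->.
by move=> k /eqP ->.
Qed.

Lemma nodeless_tall : tall nodeless.
Proof.
move=> x xi; have [Ix|/positive_node[y ny yx]] := pselect (nodeless x).
  by exists x; split=> // n.
exists (antichain y); split; first by move=> n /antichain_sub /yx.
by split; [exact/antichain_infinite/node_infinite | exact: antichain_nodeless].
Qed.

(** Take for [F] the finite sets outside [C]. The first alternative for [y] fails, since by tallness
    [y] has an infinite subset in [C], all of whose initial segments are in [C]. Under the second,
    all finite subsets of [y] are in [C], so [y] is in [C] by closedness, hence in [I]. *)
Lemma hom_no_closed_tall (I : (nat -> bool) -> Prop) :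
  (forall F : (nat -> bool) -> Prop, (forall s, F s -> finiteN s) ->
     exists y, hom F y /\ ~ I y) ->
  ~ (exists C : (nat -> bool) -> Prop,
       (forall x, C x -> I x) /\ closed2N C /\ hereditary C /\ tall C).
Proof.
move=> hom_I [C [CI [[T CT] [Cher Ctall]]]].
have [|y [[yi hy] Iy]] := hom_I (fun s => finiteN s /\ ~ C s); first by move=> s [].
case: hy => [out|inn].
  have [z [zy [zi Cz]]] := Ctall y yi.
  have [s [[_ nCs] [n sn]]] := out z zi zy; apply: nCs.
  by apply: Cher Cz _ => k; rewrite sn => /andP[].
apply/Iy/CI/CT => n; have sf : finiteN (nth false (mkseq y n)) by exact: finiteN_nth.
have sy : subsetN (nth false (mkseq y n)) y.
  by rewrite nth_mkseq_restr => k /andP[].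
have /CT/(_ n) : C (nth false (mkseq y n)).
  by apply: contrapT => nC; exact: (inn _ sf sy).
by congr T; apply/mkseq_eqP => k kn; rewrite nth_mkseq.
Qed.

(** Replaces the inductive relation by a finite path that a single real can code, as the complexity
    computation requires. *)
Lemma reach_chain y z : reach y z <-> exists k (Y F : nat -> nat -> bool),
  [/\ Y 0 = y, Y k = z & forall i, i < k -> sel (branch (Y i) (F i)) (F i) (Y i.+1)].
Proof.
split.
  elim=> {y z} [y|y G z w sz _ [k [Y [F [Y0 Yk YF]]]]].
    by exists 0, (fun=> y), (fun=> y).
  exists k.+1, (fun i => if i is j.+1 then Y j else y), (fun i => if i is j.+1 then F j else G).
  by split=> // -[_|i /YF //]; rewrite Y0.
move=> [k [Y [F [<- <- YF]]]]; elim: k YF => [|k IH] YF; first exact: reach_refl.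
by apply: reach_rcons (YF k _) => //; apply: IH => i ik; exact/YF/leqW.
Qed.

(** * Definability *)

(* A point space carries just the relation of agreeing on the first [n] data of
two points, which is enough to speak of closed sets and continuous maps. *)
Record space := Space {
  pt :> Type;
  agree : nat -> pt -> pt -> Prop;
  agree_le : forall m n p q, m <= n -> agree n p q -> agree m p q }.

Definition agree_fun (V : Type) n (z w : nat -> V) : Prop :=
  forall i, i < n -> z i = w i.

Lemma agree_fun_le V m n (z w : nat -> V) :
  m <= n -> agree_fun n z w -> agree_fun m z w.
Proof. by move=> mn zw i im; apply: zw; exact: leq_trans mn. Qed.

Definition prod_agree (S : space) n (p q : S * (nat -> nat)) : Prop :=
  agree n p.1 q.1 /\ agree_fun n p.2 q.2.

Lemma prod_agree_le (S : space) m n (p q : S * (nat -> nat)) :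
  m <= n -> prod_agree n p q -> prod_agree m p q.
Proof.
by move=> mn [pq1 pq2]; split; [exact: agree_le pq1 | exact: agree_fun_le pq2].
Qed.

Definition prod_space (S : space) : space := Space (@prod_agree_le S).

Definition cantor : space := Space (@agree_fun_le bool).

Definition cont (S : space) (V : Type) (f : S -> V) : Prop :=
  forall p, exists N, forall q, agree N p q -> f p = f q.

Definition sigma11 (S : space) (A : S -> Prop) : Prop :=
  exists C : S -> (nat -> nat) -> Prop,
    (forall p z, (forall n, exists q w, [/\ agree n p q, agree_fun n z w & C q w]) ->
       C p z) /\
    forall p, A p <-> exists z, C p z.

Lemma cont_cst (S : space) V (v : V) : cont (fun _ : S => v).
Proof. by move=> p; exists 0. Qed.

(** [V] is discrete, so [g] is constant near [p] and its value can be frozen there. This handles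
    indices that depend on the point, such as a rank or the length of a path. *)
Lemma cont_app (S : space) V W (g : S -> V) (f : S -> V -> W) :
  cont g -> (forall v, cont (fun p => f p v)) -> cont (fun p => f p (g p)).
Proof.
move=> cg cf p; have [M gM] := cg p; have [N fN] := cf (g p) p.
exists (maxn M N) => q pq.
rewrite -(gM q (agree_le (leq_maxl M N) pq)); apply: fN.
exact: agree_le (leq_maxr M N) pq.
Qed.

Lemma cont_comp (S : space) V W (g : S -> V) (f : V -> W) :
  cont g -> cont (fun p => f (g p)).
Proof. by move=> cg; apply: (cont_app (f := fun=> f)) => // v; exact: cont_cst. Qed.

Lemma cont_comp2 (S : space) V V' W (g : S -> V) (g' : S -> V') (f : V -> V' -> W) :
  cont g -> cont g' -> cont (fun p => f (g p) (g' p)).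
Proof.
by move=> cg cg'; apply: (cont_app (f := fun p v => f v (g' p))) => // v; exact: cont_comp.
Qed.

Lemma cont_fst (S : space) V (f : S -> V) : cont f -> cont (fun p : prod_space S => f p.1).
Proof. by move=> cf p; have [N fN] := cf p.1; exists N => q [/fN]. Qed.

Lemma cont_snd (S : space) i : cont (fun p : prod_space S => p.2 i).
Proof. by move=> p; exists i.+1 => q [_ /(_ i (ltnSn i))]. Qed.

Lemma sigma11_ext (S : space) (A B : S -> Prop) :
  (forall p, A p <-> B p) -> sigma11 A -> sigma11 B.
Proof. by move=> AB [C [Cc AC]]; exists C; split=> // p; rewrite -AB. Qed.

Lemma sigma11_cont (S : space) (f : S -> bool) : cont f -> sigma11 (fun p => f p).
Proof.
move=> cf; exists (fun p _ => f p); split.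
  move=> p z fcl; have [N fN] := cf p; have [q [w [pq _ fq]]] := fcl N.
  by rewrite (fN q pq).
by move=> p; split=> [fp|[]//]; exists id.
Qed.

Lemma sigma11_exN (S : space) (A : nat -> S -> Prop) :
  (forall i, sigma11 (A i)) -> sigma11 (fun p => exists i, A i p).
Proof.
(* The first entry of the witness names the index; the others form a witness for it. *)
move=> /choice[C CA]; exists (fun p z => C (z 0) p (fun n => z n.+1)); split.
  move=> p z zcl; apply: (CA _).1 => n; have [q [w [pq zw Cq]]] := zcl n.+1.
  exists q, (fun n => w n.+1); split; first exact: agree_le pq.
    by move=> i iN; exact: zw.
  by rewrite (zw 0).
move=> p; split=> [[i /(CA i).2[z Cz]]|[z Cz]].
  by exists (fun n => if n is m.+1 then z m else i).
by exists (z 0); apply/(CA _).2; exists (fun n => z n.+1).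
Qed.

Lemma sigma11_allN (S : space) (A : nat -> S -> Prop) :
  (forall i, sigma11 (A i)) -> sigma11 (fun p => forall i, A i p).
Proof.
move=> /choice[C CA]; exists (fun p z => forall i, C i p (fun n => z (pickle (i, n)))).
split.
  move=> p z zcl i; apply: (CA _).1 => n.
  (* Agreement up to this bound covers the positions [pickle (i, j)] with [j < n], hence the first
     [n] entries of slice [i]. *)
  have [q [w [pq zw Cq]]] := zcl (maxn n (\max_(j < n) (pickle (i, val j)).+1)).
  exists q, (fun n => w (pickle (i, n))); split=> //; first exact: (agree_le (leq_maxl _ _) pq).
  move=> j jn; apply: zw; rewrite leq_max; apply/orP; right.
  exact: (leq_bigmax (F := fun j : 'I_n => (pickle (i, val j)).+1) (Ordinal jn)).
move=> p; split=> [Ap|[z Cz] i]; last first.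
  by apply/(CA i).2; exists (fun n => z (pickle (i, n))); exact: Cz.
have /choice[z Cz] i : exists z, C i p z by apply/(CA i).2.
exists (fun r => if unpickle r is Some (i, n) then z i n else 0) => i.
by under [X in C i p X]funext do rewrite pickleK.
Qed.

Lemma sigma11_exfun (S : space) (A : prod_space S -> Prop) :
  sigma11 A -> sigma11 (fun p => exists w, A (p, w)).
Proof.
move=> [C [Cc CA]].
(* Even positions carry the quantified function, odd ones the witness. *)
exists (fun p z => C (p, fun n => z n.*2) (fun n => z n.*2.+1)); split.
  move=> p z zcl; apply: Cc => n; have [q [w [pq zw Cq]]] := zcl n.*2.
  exists (q, fun n => w n.*2), (fun n => w n.*2.+1); split=> //.
    split; first by apply: agree_le pq; rewrite -addnn leq_addr.
    by move=> i iN; apply: zw; rewrite ltn_double.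
  by move=> i iN; apply: zw; rewrite ltn_Sdouble.
move=> p; split=> [[w /CA[z Cz]]|[z Cz]].
  exists (fun n => if odd n then z n./2 else w n./2); move: Cz.
  congr (C (p, _) _); apply: funext => n /=; first by rewrite odd_double doubleK.
  by rewrite odd_double uphalf_double.
by exists (fun n => z n.*2); apply/CA; exists (fun n => z n.*2.+1).
Qed.

Lemma sigma11_or (S : space) (A B : S -> Prop) :
  sigma11 A -> sigma11 B -> sigma11 (fun p => A p \/ B p).
Proof.
move=> sA sB; have : sigma11 (fun p => exists i, (if i is 0 then A else B) p).
  by apply: sigma11_exN => -[].
apply: sigma11_ext => p; split=> [[[|i]]|[]]; [by left | by right | by exists 0 | by exists 1].
Qed.

Lemma sigma11_and (S : space) (A B : S -> Prop) :
  sigma11 A -> sigma11 B -> sigma11 (fun p => A p /\ B p).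
Proof.
move=> sA sB; have : sigma11 (fun p => forall i, (if i is 0 then A else B) p).
  by apply: sigma11_allN => -[].
apply: sigma11_ext => p; split=> [AB|[Ap Bp] [|i]//].
by split; [exact: (AB 0) | exact: (AB 1)].
Qed.

Lemma sigma11_ex (S : space) (I : countType) (A : I -> S -> Prop) :
  (forall i, sigma11 (A i)) -> sigma11 (fun p => exists i, A i p).
Proof.
move=> sA; have : sigma11 (fun p => exists r, if unpickle r is Some i then A i p else False).
  apply: sigma11_exN => r; case: (unpickle r) => //.
  by apply: (sigma11_ext (A := fun=> is_true false)); last exact: sigma11_cont (cont_cst false).
apply: sigma11_ext => p; split=> [[r]|[i Ai]]; last by exists (pickle i); rewrite pickleK.
by case: unpickle => // i Ai; exists i.
Qed.

Lemma sigma11_all (S : space) (I : countType) (A : I -> S -> Prop) :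
  (forall i, sigma11 (A i)) -> sigma11 (fun p => forall i, A i p).
Proof.
move=> sA; have : sigma11 (fun p => forall r, if unpickle r is Some i then A i p else True).
  apply: sigma11_allN => r; case: (unpickle r) => //.
  by apply: (sigma11_ext (A := fun=> is_true true)); last exact: sigma11_cont (cont_cst true).
apply: sigma11_ext => p; split=> [Ap i|Ap r]; last by case: unpickle.
by have := Ap (pickle i); rewrite pickleK.
Qed.

Definition delta11 (S : space) (A : S -> Prop) : Prop :=
  sigma11 A /\ sigma11 (fun p => ~ A p).

Lemma delta11_cont (S : space) (f : S -> bool) : cont f -> delta11 (fun p => f p).
Proof.
move=> cf; split; first exact: sigma11_cont.
have : sigma11 (fun p => ~~ f p) by apply: sigma11_cont; exact: cont_comp.
by apply: sigma11_ext => p; split=> /negP.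
Qed.

Lemma delta11_and (S : space) (A B : S -> Prop) :
  delta11 A -> delta11 B -> delta11 (fun p => A p /\ B p).
Proof.
move=> [sA nA] [sB nB]; split; first exact: sigma11_and.
apply: sigma11_ext (sigma11_or nA nB) => p.
by split=> [[nAp|nBp] []//|/not_andP].
Qed.

Lemma delta11_all (S : space) (I : countType) (A : I -> S -> Prop) :
  (forall i, delta11 (A i)) -> delta11 (fun p => forall i, A i p).
Proof.
move=> dA; split; first by apply: sigma11_all => i; case: (dA i).
apply: sigma11_ext (sigma11_ex (fun i => (dA i).2)) => p.
by split=> [[i nA] /(_ i)//|/existsNP].
Qed.

Lemma delta11_ex (S : space) (I : countType) (A : I -> S -> Prop) :
  (forall i, delta11 (A i)) -> delta11 (fun p => exists i, A i p).
Proof.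
move=> dA; split; first by apply: sigma11_ex => i; case: (dA i).
apply: sigma11_ext (sigma11_all (fun i => (dA i).2)) => p.
by split=> [nA [i /nA]|nA i Ai] //; apply: nA; exists i.
Qed.

Definition cont_set (S : space) (f : S -> nat -> bool) : Prop :=
  forall n, cont (fun p => f p n).

Lemma cont_set_fst (S : space) (f : S -> nat -> bool) :
  cont_set f -> cont_set (fun p : prod_space S => f p.1).
Proof. by move=> cf n; exact: (cont_fst (cf n)). Qed.

(** Every function decodes to a set and every set arises this way, so quantifiers over sets become
    quantifiers over functions. *)
Definition bits (w : nat -> nat) (n : nat) : bool := w n == 1.

Lemma bits_nat (y : nat -> bool) : bits (fun n => y n) = y.
Proof. by apply: funext => n; rewrite /bits; case: (y n). Qed.

Lemma cont_set_bits (S : space) : cont_set (fun p : prod_space S => bits p.2).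
Proof. by move=> n; exact: (cont_comp (fun m => m == 1) (cont_snd n)). Qed.

Lemma cont_mkseq (S : space) (f : S -> nat -> bool) n :
  cont_set f -> cont (fun p => mkseq (f p) n).
Proof.
move=> cf; elim: n => [|n IH]; first exact: cont_cst.
move=> p; have [N fN] := cont_comp2 rcons IH (cf n) p.
by exists N => q /fN; rewrite -!mkseqS.
Qed.

Lemma cont_rank (S : space) (f : S -> nat -> bool) n :
  cont_set f -> cont (fun p => rank (f p) n).
Proof.
move=> cf; elim: n => [|n IH]; first exact: cont_cst.
move=> p; have [N fN] := cont_comp2 (fun b r => nat_of_bool b + r) (cf n) IH p.
by exists N => q /fN; rewrite -!rankS.
Qed.

Lemma cont_all (S : space) (T : Type) (f : S -> T -> bool) (s : seq T) :
  (forall t, cont (fun p => f p t)) -> cont (fun p => all (f p) s).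
Proof.
move=> cf; elim: s => [|t s IH]; first exact: cont_cst.
exact: (cont_comp2 andb (cf t) IH).
Qed.

Lemma cont_has (S : space) (T : Type) (f : S -> T -> bool) (s : seq T) :
  (forall t, cont (fun p => f p t)) -> cont (fun p => has (f p) s).
Proof.
move=> cf; elim: s => [|t s IH]; first exact: cont_cst.
exact: (cont_comp2 orb (cf t) IH).
Qed.

Lemma cont_set_branch (S : space) (y F : S -> nat -> bool) :
  cont_set y -> cont_set F -> cont_set (fun p => branch (y p) (F p)).
Proof.
move=> cy cF n; apply: (cont_comp2 andb); first exact: cont_cst.
apply: (cont_comp2 andb) => //.
apply: (cont_app (f := fun p r => prefix_code (F p) r)); first exact: cont_rank.
move=> r; rewrite /prefix_code; case: pickle_inv => [l|]; last exact: cont_cst.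
exact: (cont_comp (fun s => l == s) (cont_mkseq _ cF)).
Qed.

Lemma cont_seg_sub (S : space) (y : S -> nat -> bool) l :
  cont_set y -> cont (fun p => seg_sub l (y p)).
Proof.
move=> cy; apply: (cont_all (f := fun p k => nth false l k ==> y p k)) => k.
exact: (cont_comp (implb (nth false l k)) (cy k)).
Qed.

Lemma delta11_infinite (S : space) (y : S -> nat -> bool) :
  cont_set y -> delta11 (fun p => infiniteN (y p)).
Proof.
move=> cy; apply: delta11_all => n; apply: delta11_ex => m; apply: delta11_and.
  by apply: delta11_cont; exact: cont_cst.
exact: delta11_cont.
Qed.

Lemma delta11_imp_cont (S : space) (f : S -> bool) (A : S -> Prop) :
  cont f -> delta11 A -> delta11 (fun p => f p -> A p).
Proof.
move=> cf [sA nA]; split.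
  have : sigma11 (fun p => ~~ f p \/ A p).
    by apply: sigma11_or => //; apply: sigma11_cont; exact: cont_comp.
  by apply: sigma11_ext => p; split=> [[/negP//|//]|fA]; case: (boolP (f p)); [right; exact: fA | left].
apply: sigma11_ext (sigma11_and (sigma11_cont cf) nA) => p.
by split=> [[fp nAp] /(_ fp)|/not_implyP].
Qed.

Lemma delta11_sub (S : space) (y b : S -> nat -> bool) :
  cont_set y -> cont_set b -> delta11 (fun p => subsetN (y p) (b p)).
Proof.
move=> cy cb; apply: delta11_all => n; apply: delta11_imp_cont => //.
exact: delta11_cont.
Qed.

Lemma delta11_and3 (S : space) (A B C : S -> Prop) :
  delta11 A -> delta11 B -> delta11 C -> delta11 (fun p => [/\ A p, B p & C p]).
Proof.
move=> dA dB dC; have [s n] := delta11_and dA (delta11_and dB dC).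
have e p : A p /\ B p /\ C p <-> [/\ A p, B p & C p] by split=> [[? []]|[]].
by split; [apply: sigma11_ext s | apply: sigma11_ext n => p; rewrite e].
Qed.

Lemma delta11_homE (S : space) (b F y : S -> nat -> bool) :
  cont_set b -> cont_set F -> cont_set y ->
  delta11 (fun p => homE (b p) (F p) (y p)).
Proof.
move=> cb cF cy; apply: delta11_and3; [exact: delta11_infinite | exact: delta11_sub |].
apply: delta11_all => l; apply: delta11_imp_cont; first exact: cont_seg_sub.
by apply: delta11_cont; apply: cont_comp; exact: cF.
Qed.

Lemma delta11_homK (S : space) (b F y : S -> nat -> bool) :
  cont_set b -> cont_set F -> cont_set y ->
  delta11 (fun p => homK (b p) (F p) (y p)).
Proof.
move=> cb cF cy; apply: delta11_and3; [exact: delta11_infinite | exact: delta11_sub |].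
apply: delta11_all => l; apply: delta11_all => l'.
apply: delta11_imp_cont; first exact: cont_seg_sub.
apply: delta11_imp_cont; first exact: cont_cst.
apply: delta11_imp_cont; first exact: cF.
apply: delta11_cont.
exact: (cont_has (f := fun p n => F p (pickle (take n l)))).
Qed.

Lemma sigma11_exset (S : space) (A : S -> (nat -> bool) -> Prop) :
  sigma11 (fun p : prod_space S => A p.1 (bits p.2)) ->
  sigma11 (fun p => exists y, A p y).
Proof.
move=> /sigma11_exfun; apply: sigma11_ext => p; split=> [[w Aw]|[y Ay]].
  by exists (bits w).
by exists (fun n => y n); rewrite /= bits_nat.
Qed.

Lemma sigma11_beats (S : space) (y z : S -> nat -> bool) :
  cont_set y -> cont_set z -> sigma11 (fun p => beats (y p) (z p)).
Proof.
move=> cy cz; apply: sigma11_ex => n; apply: sigma11_cont.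
apply: (cont_comp2 andb).
  by apply: (cont_comp2 (fun s t : seq bool => s == t)); exact: cont_mkseq.
by apply: (cont_comp2 (fun a c => a && ~~ c)); [exact: cy | exact: cz].
Qed.

Lemma sigma11_not_leftmost (S : space) (H : S -> (nat -> bool) -> Prop)
    (y : S -> nat -> bool) :
  cont_set y -> delta11 (fun p => H p (y p)) ->
  delta11 (fun p : prod_space S => H p.1 (bits p.2)) ->
  sigma11 (fun p => ~ leftmost (H p) (y p)).
Proof.
move=> cy [_ nHy] [sH _].
have : sigma11 (fun p => ~ H p (y p) \/ exists z, H p z /\ beats z (y p)).
  apply: sigma11_or => //.
  apply: (sigma11_exset (A := fun p z => H p z /\ beats z (y p))).
  apply: sigma11_and => //; apply: sigma11_beats; first exact: cont_set_bits.
  exact: cont_set_fst.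
apply: sigma11_ext => p; split=> [[nH|[z [Hz bz]]] [Hy ly]//|nl]; first exact: ly bz.
have [Hy|] := pselect (H p (y p)); last by left.
right; apply: contrapT => nz; apply: nl; split=> // z Hz bz.
by apply: nz; exists z.
Qed.

(** The negation says that [y] is not leftmost in [homE] and that either [homE] has a member or [y]
    is not leftmost in [homK]. Failing to be leftmost is existential: [y] is outside the set, or
    some member beats it. *)
Lemma sigma11_not_sel (S : space) (b F y : S -> nat -> bool) :
  cont_set b -> cont_set F -> cont_set y ->
  sigma11 (fun p => ~ sel (b p) (F p) (y p)).
Proof.
move=> cb cF cy.
have cb' := cont_set_fst cb; have cF' := cont_set_fst cF.
have dE := delta11_homE cb' cF' (@cont_set_bits S).
have dK := delta11_homK cb' cF' (@cont_set_bits S).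
have nE := sigma11_not_leftmost (H := fun p => homE (b p) (F p)) cy (delta11_homE cb cF cy) dE.
have nK := sigma11_not_leftmost (H := fun p => homK (b p) (F p)) cy (delta11_homK cb cF cy) dK.
have eE := sigma11_exset (A := fun p => homE (b p) (F p)) dE.1.
apply: sigma11_ext (sigma11_and nE (sigma11_or eE nK)) => p.
split=> [[nl e] [//|[nz l]]|ns]; first by case: e => // -[z /nz].
split; first by move=> l; apply: ns; left.
have [e|ne] := pselect (exists z, homE (b p) (F p) z); first by left.
by right=> l; apply: ns; right; split=> // z Ez; apply: ne; exists z.
Qed.

Lemma sigma11_Pi12 (A : (nat -> bool) -> Prop) (B : prod_space cantor -> Prop) :
  sigma11 B -> (forall x, A x <-> forall y, B (x, y)) -> Pi12 A.
Proof.
move=> [C [Cc CB]] AB; exists (fun x y z => C (x, y) z); split; last first.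
  by move=> x; rewrite AB; split=> Bx y; apply/CB/Bx.
(* The tree of initial segments of the points of [C]; the common length [n] lets closedness recover
   [C] from it. *)
exists (fun a b c => exists x y z n,
  [/\ C (x, y) z, a = mkseq x n, b = mkseq y n & c = mkseq z n]).
move=> x y z; split=> [Cxyz n|Tn]; first by exists x, y, z, n.
have agr V (u v : nat -> V) n : mkseq u n = mkseq v n -> agree_fun n u v.
  by move=> uv i iN; rewrite -(nth_mkseq (u i) u iN) uv nth_mkseq.
apply: Cc => n; have [x' [y' [z' [m [C' xx yy zz]]]]] := Tn n.
have nm : n = m by move/(congr1 size): xx; rewrite !size_mkseq.
by exists (x', y'), z'; split=> //; [split|]; apply: agr; rewrite ?xx ?yy ?zz nm.
Qed.

Lemma nodeless_Pi12 : Pi12 nodeless.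
Proof.
(* One real codes a whole path: its length at [None], and the bits of the nodes and of the chosen
   reals at [Some]. *)
pose dig (c : option (bool * nat * nat)) (p : prod_space cantor) : nat := p.2 (pickle c).
pose k := dig None.
pose Y i (p : prod_space cantor) n := dig (Some (true, i, n)) p == 1.
pose F i (p : prod_space cantor) n := dig (Some (false, i, n)) p == 1.
have cdig c : cont (dig c) by exact: cont_snd.
have cY i : cont_set (Y i) by move=> n; exact: (cont_comp (fun m => m == 1) (cdig _)).
have cF i : cont_set (F i) by move=> n; exact: (cont_comp (fun m => m == 1) (cdig _)).
(* The real fails to code a path from the full set to a node included in [p.1]: the start, a step or
   the end is wrong. *)
pose bad (p : prod_space cantor) := (exists n, ~~ Y 0 p n) \/
  ((exists i, i < k p /\ ~ sel (branch (Y i p) (F i p)) (F i p) (Y i.+1 p)) \/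
   exists n, Y (k p) p n && ~~ (p.1 : nat -> bool) n).
apply: (sigma11_Pi12 (B := bad)).
  apply: sigma11_or.
    by apply: sigma11_ex => n; apply: sigma11_cont; apply: cont_comp; exact: cY.
  apply: sigma11_or.
    apply: sigma11_ex => i; apply: sigma11_and.
      by apply: sigma11_cont; exact: (cont_comp (fun m => i < m) (cdig _)).
    by apply: sigma11_not_sel => //; exact: cont_set_branch.
  apply: sigma11_ex => n; apply: sigma11_cont.
  apply: (cont_comp2 (fun a c => a && ~~ c)).
    by apply: (cont_app (f := fun p i => Y i p n) (cdig None)) => i; exact: cY.
  by move=> p; exists n.+1 => q [pq _]; exact: pq.
move=> x; split=> [Ix w|Bx y /reach_chain[m [Z [G [Z0 <- ZG]]]] Zx].
  apply: contrapT => good; apply: (Ix (Y (k (x, w)) (x, w))).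
    apply/reach_chain; exists (k (x, w)), (Y^~ (x, w)), (F^~ (x, w)); split=> //.
      apply: funext => n; apply: contrapT => /negP Yn; apply: good; left.
      by exists n; move/negP: Yn; case: (Y 0 _ n).
    move=> i ik; apply: contrapT => ns; apply: good; right; left.
    by exists i.
  move=> n Yn; apply: contrapT => /negP xn; apply: good; right; right.
  by exists n; rewrite Yn.
pose digit (c : option (bool * nat * nat)) : nat :=
  if c is Some (t, i, n) then (if t then Z i n else G i n) else m.
pose w r := if unpickle r is Some c then digit c else 0.
have wE c : dig c (x, w) = digit c.
  by have -> : dig c (x, w) = w (pickle c) by []; rewrite /w pickleK.
have kw : k (x, w) = m by exact: wE.
have Yw i : Y i (x, w) = Z i.
  by apply: funext => n; rewrite /Y wE /=; case: (Z i n).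
have Fw i : F i (x, w) = G i.
  by apply: funext => n; rewrite /F wE /=; case: (G i n).
case: (Bx w) => [[n]|[[i []]|[n]]]; first by rewrite Yw Z0.
  by rewrite kw !Yw Fw => /ZG.
by rewrite kw Yw => /andP[/Zx xn]; rewrite /= xn.
Qed.

Theorem mainTheorem4 :
  exists I : (nat -> bool) -> Prop,
    is_ideal I /\ tall I /\ Pi12 I /\
    (forall x : nat -> bool, ~ I x ->
       forall F : (nat -> bool) -> Prop, (forall s, F s -> finiteN s) ->
         exists y, subsetN y x /\ hom F y /\ ~ I y) /\
    ~ (exists C : (nat -> bool) -> Prop,
         (forall x, C x -> I x) /\ closed2N C /\ hereditary C /\ tall C).
Proof.
have hom_pos x : ~ nodeless x -> forall F : (nat -> bool) -> Prop,
    (forall s, F s -> finiteN s) ->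
    exists y, subsetN y x /\ hom F y /\ ~ nodeless y.
  by move=> Nx F _; exact: nodeless_hom.
exists nodeless; split; first exact: nodeless_ideal.
split; first exact: nodeless_tall.
split; first exact: nodeless_Pi12.
split=> //; apply: hom_no_closed_tall => F fF.
have [|y [_ [Fy ny]]] := hom_pos (fun=> true) _ F fF; last by exists y.
by move=> /(_ _ (reach_refl _)); apply.
Qed.
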